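(* Assume that: (a) the model $\{r(\cdot;\theta):\theta\in\Theta\}$ contains the constant function $1$; (b) for every $\theta\in\Theta$, the constant function $1$ belongs to $\mathcal{L}[\nabla\log r(x;\theta)]$; (c) $f(1)=f'(1)=0$. Then the estimator of the $f$-divergence built from $$f_{\mathrm d}(r)=\frac{f(r)}{1+\rho r},\qquad f_{\mathrm n}(r)=\frac{\rho f(r)}{1+\rho r},\qquad \eta(x;\theta)=\eta_{\mathrm{opt}}(x;\theta)=\frac{1}{1+\rho r(x;\theta)}\nabla\log r(x;\theta)$$ is an optimal estimator of the $f$-divergence: for every $\theta^*\in\Theta$ and all densities with $p_{\mathrm n}/p_{\mathrm d}=r(\cdot;\theta^* )$, its asymptotic variance is less than or equal to that of the estimator built from any vector-valued function $\eta$ and any decomposition $f(r)=f_{\mathrm d}(r)+rf_{\mathrm n}(r)$.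
   Context: Let $p_{\mathrm n},p_{\mathrm d}$ be probability densities on $\mathcal{X}$ and $f$ a strictly convex differentiable function on $(0,\infty)$ with $f(1)=0$. The $f$-divergence is $D_f=D_f(p_{\mathrm d},p_{\mathrm n})=\int p_{\mathrm d}(x)f(p_{\mathrm n}(x)/p_{\mathrm d}(x))\,dx$. $\mathrm{E}_{\mathrm n},\mathrm{V}_{\mathrm n}$ (resp. $\mathrm{E}_{\mathrm d},\mathrm{V}_{\mathrm d}$) denote expectation and variance under $p_{\mathrm n}$ (resp. $p_{\mathrm d}$). A density-ratio model is a family of positive functions $r(x;\theta)$, $\theta\in\Theta\subset\mathbb{R}^d$, differentiable in $\theta$; the model is correctly specified, i.e. $p_{\mathrm n}(x)/p_{\mathrm d}(x)=r(x;\theta^* )$ for some $\theta^*\in\Theta$. $\nabla$ is the gradient in $\theta$ (column vector). $\mathcal{L}[\nabla\log r(x;\theta)]$ is the linear span, as functions of $x$, of $\partial_1\log r(x;\theta),\dots,\partial_d\log r(x;\theta)$. Data: independent i.i.d. samples $x^{(\mathrm n)}_1,\dots,x^{(\mathrm n)}_{m_{\mathrm n}}\sim p_{\mathrm n}$ and $x^{(\mathrm d)}_1,\dots,x^{(\mathrm d)}_{m_{\mathrm d}}\sim p_{\mathrm d}$. Put $m=m_{\mathrm n}m_{\mathrm d}/(m_{\mathrm n}+m_{\mathrm d})$; $\rho\in(0,\infty)$ is the limit of $m_{\mathrm n}/m_{\mathrm d}$. For $\eta(x;\theta)\in\mathbb{R}^d$, the moment matching estimator $\widehat\theta$ solves $Q_\eta(\widehat\theta)=0$,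 where $$Q_\eta(\theta)=\frac1{m_{\mathrm d}}\sum_{i=1}^{m_{\mathrm d}}r(x^{(\mathrm d)}_i;\theta)\eta(x^{(\mathrm d)}_i;\theta)-\frac1{m_{\mathrm n}}\sum_{j=1}^{m_{\mathrm n}}\eta(x^{(\mathrm n)}_j;\theta).$$ A decomposition of $f$ is a pair of functions with $f(r)=f_{\mathrm d}(r)+rf_{\mathrm n}(r)$. The associated estimator built from $\eta$ and $(f_{\mathrm d},f_{\mathrm n})$ is $$\widehat D_f=\frac1{m_{\mathrm d}}\sum_{i=1}^{m_{\mathrm d}}f_{\mathrm d}(r(x^{(\mathrm d)}_i;\widehat\theta))+\frac1{m_{\mathrm n}}\sum_{j=1}^{m_{\mathrm n}}f_{\mathrm n}(r(x^{(\mathrm n)}_j;\widehat\theta)).$$ Set $U_\eta=\mathrm{E}_{\mathrm n}[\eta\,\nabla\log r^T]$ (a $d\times d$ matrix, assumed non-degenerate for every $\eta$ considered, including $\eta_{\mathrm{opt}}$) and $c=\mathrm{E}_{\mathrm n}[\{f'(r)-f_{\mathrm n}(r)\}\nabla\log r]$. Under standing regularity conditions, $\sqrt m(\widehat D_f-D_f)=\mathbb{P}f-\sqrt m\,c^TU_\eta^{-1}Q_\eta(\theta^* )+o_p(1)$ with everything evaluated at $\theta^*$, where $$\mathbb{P}f=\sqrt{\tfrac{\rho}{\rho+1}}\tfrac1{\sqrt{m_{\mathrm d}}}\sum_{i}\big[f_{\mathrm d}(r(x_i^{(\mathrm d)}))-\mathrm{E}_{\mathrm d}f_{\mathrm d}(r)\big]+\sqrt{\tfrac{1}{\rho+1}}\tfrac1{\sqrt{m_{\mathrm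 n}}}\sum_{j}\big[f_{\mathrm n}(r(x_j^{(\mathrm n)}))-\mathrm{E}_{\mathrm n}f_{\mathrm n}(r)\big].$$ The asymptotic variance of $\widehat D_f$ is the (limiting) variance of this leading term, namely $$\frac{\rho}{1+\rho}\mathrm{V}_{\mathrm d}\big[f_{\mathrm d}(r)-c^TU_\eta^{-1}r\eta\big]+\frac1{1+\rho}\mathrm{V}_{\mathrm n}\big[f_{\mathrm n}(r)+c^TU_\eta^{-1}\eta\big],$$ evaluated at $\theta=\theta^*$; all functions involved are assumed to have the required finite second moments. *)

(* Defs.v *)
From HB Require Import structures.
From mathcomp Require Import all_boot all_order all_algebra.
From mathcomp Require Import all_classical all_reals all_analysis.

Set Implicit Arguments.
Unset Strict Implicit.
Unset Printing Implicit Defensive.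

Import Order.TTheory GRing.Theory Num.Theory.
Import numFieldNormedType.Exports.

Local Open Scope classical_set_scope.
Local Open Scope ring_scope.

Definition strictly_convex_pos (R : realType) (f : R -> R) : Prop :=
  forall a b t : R, 0 < a -> 0 < b -> a != b -> 0 < t -> t < 1 ->
    f (t * a + (1 - t) * b) < t * f a + (1 - t) * f b.

Definition has_density (R : realType) (disp : measure_display)
    (X : measurableType disp) (mu : {measure set X -> \bar R})
    (P : probability X R) (p : X -> R) : Prop :=
  [/\ measurable_fun [set: X] p,
      forall x, 0 <= p x &
      forall A, measurable A -> P A = (\int[mu]_(x in A) (p x)%:E)%E].

(* f(t) = fd(t) + t fn(t) on the domain (0, +oo) of f. *)
Definition decomposition (R : realType) (f fd fn : R -> R) : Prop :=
  forall t, 0 < t -> f t = fd t + t * fn t.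

Definition in_span (R : realType) (X : Type) (d : nat)
    (g : X -> 'cV[R]_d) (h : X -> R) : Prop :=
  exists a : 'I_d -> R, forall x, h x = \sum_(i < d) a i * g x i ord0.

(* Gradient, with respect to theta, of log r(x; theta). *)
Definition grad_log (R : realType) (X : Type) (d : nat)
    (r : X -> 'cV[R]_d -> R) (x : X) (theta : 'cV[R]_d) : 'cV[R]_d :=
  \col_(i < d) 'D_(delta_mx i ord0) (fun t : 'cV[R]_d => ln (r x t)) theta.

Section AsymptoticVariance.
Context (R : realType) (disp : measure_display) (X : measurableType disp).
Context (d : nat) (Pn Pd : probability X R) (rho : R) (f : R -> R).
Context (r : X -> 'cV[R]_d -> R).
Context (eta : X -> 'cV[R]_d -> 'cV[R]_d) (fd fn : R -> R).
Context (theta : 'cV[R]_d).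

(* U_eta = E_n[eta (grad log r)^T] *)
Definition U_mx : 'M[R]_d :=
  \matrix_(i < d, j < d)
    fine ('E_Pn[fun x =>
                (eta x theta i ord0 * grad_log r x theta j ord0)%R])%E.

(* c = E_n[(f'(r) - fn(r)) grad log r] *)
Definition c_vec : 'cV[R]_d :=
  \col_(i < d)
    fine ('E_Pn[fun x => ((derive1 f (r x theta) - fn (r x theta))
                          * grad_log r x theta i ord0)%R])%E.

(* c^T U_eta^-1 eta(x; theta), a 1 x 1 matrix read as a scalar *)
Definition cUeta (x : X) : R :=
  (c_vec^T *m invmx U_mx *m eta x theta) ord0 ord0.

(* With m = mn md / (mn + md) and mn / md -> rho, this is the limiting variance
   of the leading term  Pf - sqrt m c^T U_eta^-1 Q_eta(theta)  in the expansion
   of sqrt m (hat D_f - D_f): the md samples from Pd and the mn samples from Pn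
   are independent, m / md -> rho / (1 + rho) and m / mn -> 1 / (1 + rho). *)
Definition asymptotic_variance : \bar R :=
  ((rho / (1 + rho))%:E
     * 'V_Pd[fun x => (fd (r x theta) - r x theta * cUeta x)%R]
   + (1 / (1 + rho))%:E
     * 'V_Pn[fun x => (fn (r x theta) + cUeta x)%R])%E.

(* Existence of the moments entering U_eta, c and the asymptotic variance. *)
Definition finite_moments : Prop :=
  [/\ (fun x => fd (r x theta)) \in Lfun Pd 2%:E,
      (fun x => fn (r x theta)) \in Lfun Pn 2%:E,
      forall i : 'I_d,
        (fun x => r x theta * eta x theta i ord0) \in Lfun Pd 2%:E
        /\ (fun x => eta x theta i ord0) \in Lfun Pn 2%:E,
      forall i j : 'I_d,
        (fun x => eta x theta i ord0 * grad_log r x theta j ord0)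
          \in Lfun Pn 1%E &
      forall i : 'I_d,
        (fun x => (derive1 f (r x theta) - fn (r x theta))
                  * grad_log r x theta i ord0) \in Lfun Pn 1%E].

End AsymptoticVariance.

Definition fd_opt (R : realType) (rho : R) (f : R -> R) (t : R) : R :=
  f t / (1 + rho * t).

Definition fn_opt (R : realType) (rho : R) (f : R -> R) (t : R) : R :=
  rho * f t / (1 + rho * t).

Definition eta_opt (R : realType) (X : Type) (d : nat) (rho : R)
    (r : X -> 'cV[R]_d -> R) (x : X) (theta : 'cV[R]_d) : 'cV[R]_d :=
  (1 / (1 + rho * r x theta)) *: grad_log r x theta.

(* Main.v *)
Require Import Defs.
From HB Require Import structures.
From mathcomp Require Import all_boot all_order all_algebra.
From mathcomp Require Import all_classical all_reals all_analysis.
From mathcomp Require Import measurable_realfun ring.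

Set Implicit Arguments.
Unset Strict Implicit.
Unset Printing Implicit Defensive.

Import Order.TTheory GRing.Theory Num.Theory.
Import numFieldNormedType.Exports.

Local Open Scope classical_set_scope.
Local Open Scope ring_scope.

(** Put g = fn(r) + c^T U_eta^-1 eta.  Since fd(r) - c^T U_eta^-1 r eta = f(r) - r g,
    the asymptotic variance depends on the estimator only through g, and the
    definitions of c and U_eta say exactly that E_n[(g - f'(r)) grad log r] = 0.
    So if g0 is the function attached to the proposed estimator, h = g - g0 is
    Pn-orthogonal to grad log r, hence to the constant 1 in its span; as
    (1 + rho r) g0 - rho f(r) is a linear combination of grad log r, the cross
    terms in the expansion of the variances around g0 cancel, and only the
    nonnegative contribution of V_d[r h] and V_n[h] remains. *)

(** * Change of measure between probabilities with densities *)

Section Density.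
Context (R : realType) (disp : measure_display) (X : measurableType disp).
Context (mu : {measure set X -> \bar R}).
Implicit Types P : probability X R.

Import HBNNSimple.

(** Monotone convergence along simple functions reduces the identity to indicators of level sets,
    where it is the defining property of a density. *)
Lemma ge0_integral_density P (p : X -> R) (g : X -> \bar R) :
    has_density mu P p -> measurable_fun [set: X] g -> (forall x, 0 <= g x)%E ->
  (\int[P]_x g x = \int[mu]_x (g x * (p x)%:E))%E.
Proof.
move=> [mp p0 PE] mg g0.
have mpE : measurable_fun [set: X] (EFin \o p) by exact/measurable_EFinP.
pose h := nnsfun_approx measurableT mg.
have gE x : g x = lim ((EFin \o h n) x @[n --> \oo]).
  by apply/esym/cvg_lim => //; exact: cvg_nnsfun_approx.
have gpE x : (g x * (p x)%:E)%E = lim (((EFin \o h n) \* (EFin \o p))%E x @[n --> \oo]).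
  by apply/esym/cvg_lim => //; apply: cvgeZr => //; exact: cvg_nnsfun_approx.
rewrite (eq_integral _ _ (fun x _ => gE x)) [RHS](eq_integral _ _ (fun x _ => gpE x)).
rewrite monotone_convergence//=; last 3 first.
- by move=> n; apply/measurable_EFinP.
- by move=> n x _; rewrite lee_fin.
- by move=> x _ a b ab; rewrite lee_fin; exact/lefP/nd_nnsfun_approx.
rewrite monotone_convergence//=; last 3 first.
- by move=> n; apply/emeasurable_funM => //; exact/measurable_EFinP.
- by move=> n x _; rewrite mule_ge0 ?lee_fin.
- move=> x _ a b ab; rewrite lee_wpmul2r ?lee_fin//.
  exact/lefP/nd_nnsfun_approx.
suff simpleE n : (\int[P]_x (h n x)%:E = \int[mu]_x ((h n x)%:E * (p x)%:E))%E.
  by under eq_fun do rewrite simpleE.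
have indich r : measurable_fun setT (fun x => (r * \1_(h n @^-1` [set r]) x)%:E).
  by apply/measurable_EFinP; exact: measurable_funM.
rewrite integralT_nnsfun sintegralE.
rewrite [RHS](eq_integral (fun x => \sum_(y \in range (h n))
    (y * \1_(h n @^-1` [set y]) x)%:E * (p x)%:E))%E; last first.
  move=> x _; rewrite fimfunE -fsumEFin//.
  rewrite ge0_mule_fsuml// => y; exact: nnfun_muleindic_ge0.
rewrite ge0_integral_fsum//; last 2 first.
  - by move=> y; apply: emeasurable_funM.
  - move=> y x _; apply: mule_ge0; last by rewrite lee_fin.
    exact: nnfun_muleindic_ge0.
apply: eq_fsbigr => r rhn.
under [RHS]eq_integral do rewrite EFinM -muleA.
rewrite ge0_integralZl//.
- congr (_ * _)%E; under [RHS]eq_integral do rewrite muleC.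
  rewrite [RHS](eq_integral ((EFin \o p) \_ (h n @^-1` [set r]))); last first.
    by move=> x _; rewrite epatch_indic.
  by rewrite -integral_mkcond -PE.
- by apply: emeasurable_funM => //; exact/measurable_EFinP.
- by move=> t _; rewrite mule_ge0 ?lee_fin.
- by move: rhn; rewrite inE => -[t _ <-]; rewrite lee_fin.
Qed.

(** The ratio enters as a function [w] rather than as [p / q], since [q] may vanish. Once both
    integrals are taken against [mu], an almost everywhere identity suffices. *)
Lemma ge0_integral_density_ratio P Q (p q w : X -> R) (g : X -> \bar R) :
    has_density mu P p -> has_density mu Q q ->
    measurable_fun [set: X] w -> (forall x, 0 <= w x) ->
    {ae mu, forall x, p x = w x * q x} ->
    measurable_fun [set: X] g -> (forall x, 0 <= g x)%E ->
  (\int[P]_x g x = \int[Q]_x (g x * (w x)%:E))%E.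
Proof.
move=> Pp Qq mw w0 pwq mg g0.
have mwE : measurable_fun [set: X] (EFin \o w) by exact/measurable_EFinP.
have [mp p0 _] := Pp; have [mq q0 _] := Qq.
rewrite (ge0_integral_density Pp)// (ge0_integral_density Qq); last 2 first.
- exact: emeasurable_funM.
- by move=> x; rewrite mule_ge0 ?lee_fin.
apply: ge0_ae_eq_integral => //.
- by apply: emeasurable_funM => //; exact/measurable_EFinP.
- apply: emeasurable_funM; last exact/measurable_EFinP.
  exact: emeasurable_funM.
- by move=> x _; rewrite mule_ge0 ?lee_fin.
- by move=> x _; rewrite !mule_ge0 ?lee_fin.
- by apply: filterS pwq => x pE _; rewrite pE EFinM muleA.
Qed.

Section Ratio.
Context (P Q : probability X R) (p q w : X -> R).
Hypothesis Pp : has_density mu P p.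
Hypothesis Qq : has_density mu Q q.
Hypothesis mw : measurable_fun [set: X] w.
Hypothesis w_gt0 : forall x, 0 < w x.
Hypothesis pwq : {ae mu, forall x, p x = w x * q x}.

Let w_ge0 x : 0 <= w x. Proof. exact: ltW. Qed.

Lemma Lfun1_density_ratio (k : X -> R) : measurable_fun [set: X] k ->
  (k \in Lfun P 1%E) = ((fun x => w x * k x) \in Lfun Q 1%E).
Proof.
move=> mk.
have intE : (\int[P]_x `|(k x)%:E| = \int[Q]_x `|(w x * k x)%:E|)%E.
  rewrite (ge0_integral_density_ratio Pp Qq mw)//.
    apply: eq_integral => x _.
    by rewrite mulrC EFinM abseM [in RHS](@gee0_abs _ (w x)%:E%E) ?lee_fin.
  by apply: measurableT_comp => //; exact/measurable_EFinP.
apply/idP/idP => /Lfun1_integrable/integrableP[_ ik];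
  apply/Lfun1_integrable/integrableP; split.
- by apply/measurable_EFinP; exact: measurable_funM.
- by rewrite -intE.
- exact/measurable_EFinP.
- by rewrite intE.
Qed.

(** Multiplication by the positive [w] commutes with taking positive and negative parts, so the
    nonnegative case applies to each part. *)
Lemma expectation_density_ratio (k : X -> R) : measurable_fun [set: X] k ->
  ('E_P[k] = 'E_Q[(fun x => w x * k x)%R])%E.
Proof.
move=> mk; have mkE : measurable_fun [set: X] (EFin \o k) by exact/measurable_EFinP.
rewrite unlock integralE [RHS]integralE; congr (_ - _)%E.
- rewrite (ge0_integral_density_ratio Pp Qq mw)//.
    apply: eq_integral => x _.
    by rewrite !funeposE muleC maxe_pMr ?lee_fin// mule0 EFinM.
  exact: measurable_funepos.
- rewrite (ge0_integral_density_ratio Pp Qq mw)//.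
    apply: eq_integral => x _.
    by rewrite !funenegE muleC maxe_pMr ?lee_fin// mule0 muleN EFinM.
  exact: measurable_funeneg.
Qed.

End Ratio.
End Density.

(** * Integrable functions of mean zero *)

Section Centered.
Context (R : realType) (disp : measure_display) (X : measurableType disp).
Context (P : probability X R).

(** Integrability is bundled in because linearity of the extended-real expectation relies on it. *)
Definition centered (k : X -> R) : Prop :=
  k \in Lfun P 1%E /\ 'E_P[k]%E = 0%E.

Lemma centered_sum (d : nat) (a : 'I_d -> R) (k : 'I_d -> X -> R) :
    (forall i, centered (k i)) ->
  centered (fun x => \sum_(i < d) a i * k i x).
Proof.
move=> ck; elim: d a k ck => [|d IH] a k ck.
  rewrite (_ : (fun x => _) = cst 0); last first.
    by apply/funext => x; rewrite big_ord0.
  by split; [exact: Lfun_cst | rewrite expectation_cst].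
rewrite (_ : (fun x => _) =
    a ord0 \o* k ord0 \+ (fun x => \sum_(i < d) a (lift ord0 i) * k (lift ord0 i) x)); last first.
  by apply/funext => x; rewrite big_ord_recl /= mulrC.
have [k0 Ek0] := ck ord0.
have [ks Eks] := IH (fun i => a (lift ord0 i)) (fun i => k (lift ord0 i)) (fun i => ck _).
have ak0 : a ord0 \o* k ord0 \in Lfun P 1%E by exact: Lfun_scale.
split; first by rewrite rpredD.
by rewrite expectationD// expectationZl// Ek0 Eks mule0 adde0.
Qed.

Lemma centered_subr_expectation (k : X -> R) : k \in Lfun P 1%E ->
  centered (k \- cst (fine 'E_P[k]%E)).
Proof.
move=> k1; have c1 : cst (fine 'E_P[k]%E) \in Lfun P 1%E by exact: Lfun_cst.
split; first by rewrite rpredB.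
by rewrite expectationB// expectation_cst fineK ?subee// expectation_fin_num.
Qed.

Lemma centeredB (k l : X -> R) : centered k -> centered l ->
  centered (k \- l).
Proof.
move=> [k1 Ek] [l1 El]; split; first by rewrite rpredB.
by rewrite expectationB// Ek El sube0.
Qed.

Lemma covariance_centered (f k : X -> R) :
    f \in Lfun P 2%:E -> k \in Lfun P 2%:E -> 'E_P[k]%E = 0%E ->
  covariance P f k = 'E_P[f \* k]%E.
Proof.
move=> f2 k2 Ek.
have PT : P setT \is a fin_num := fin_num_measure P _ measurableT.
have fk1 : (f * k)%R \in Lfun P 1%E := Lfun2_mul_Lfun1 f2 k2.
have EM := covarianceE (Lfun_subset12 PT f2) (Lfun_subset12 PT k2) fk1.
by rewrite EM Ek mule0 sube0.
Qed.

End Centered.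

(** * Comparison of weighted sums of variances *)

Section WeightedVariance.
Context (R : realType) (disp : measure_display) (X : measurableType disp).
Context (mu : {measure set X -> \bar R}).
Context (P Q : probability X R) (p q w : X -> R).
Hypothesis Pp : has_density mu P p.
Hypothesis Qq : has_density mu Q q.
Hypothesis mw : measurable_fun [set: X] w.
Hypothesis w_gt0 : forall x, 0 < w x.
Hypothesis pwq : {ae mu, forall x, p x = w x * q x}.

(** Meant for [w = r], [F = f(r)]. With [h = g - g0], [H = w h] and [G0 = F - w g0], the variances
    to expand are those of [G0 - H] under [Q] and [g0 + h] under [P]. The last hypothesis says that
    [cov_P(g0, h) = rho cov_Q(G0, H)], which makes the weighted cross terms cancel. *)
Lemma weighted_variance_le (rho : R) (F g g0 : X -> R) :
    0 < rho -> measurable_fun [set: X] F ->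
    g \in Lfun P 2%:E -> g0 \in Lfun P 2%:E ->
    (fun x => F x - w x * g x) \in Lfun Q 2%:E ->
    (fun x => F x - w x * g0 x) \in Lfun Q 2%:E ->
    centered P (g \- g0) ->
    centered P (fun x => (g x - g0 x) * ((1 + rho * w x) * g0 x - rho * F x)) ->
  ((rho / (1 + rho))%:E * 'V_Q[(fun x => F x - w x * g0 x)%R]
     + (1 / (1 + rho))%:E * 'V_P[g0]
   <= (rho / (1 + rho))%:E * 'V_Q[(fun x => F x - w x * g x)%R]
     + (1 / (1 + rho))%:E * 'V_P[g])%E.
Proof.
move=> rho_gt0 mF g2 g02 G2 G02 ch [k1 Ek].
pose h := g \- g0; have [h1 Eh] : centered P h := ch.
pose H x := w x * h x; pose G0 x := F x - w x * g0 x.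
have h2 : h \in Lfun P 2%:E by rewrite rpredB ?lee1n.
have gE : g = g0 \+ h by apply/funext => x; rewrite /h /= subrKC.
have GE : (fun x => F x - w x * g x) = G0 \- H.
  by apply/funext => x; rewrite /G0 /H /h /=; ring.
have H2 : H \in Lfun Q 2%:E.
  rewrite (_ : H = G0 \- (fun x => F x - w x * g x)) ?rpredB ?lee1n//.
  by apply/funext => x; rewrite /G0 /H /h /=; ring.
have PT : P setT \is a fin_num := fin_num_measure P _ measurableT.
have QT : Q setT \is a fin_num := fin_num_measure Q _ measurableT.
have mh : measurable_fun [set: X] h by move: h2 => /sub_Lfun_mfun /[!inE].
have mg0 : measurable_fun [set: X] g0 by move: g02 => /sub_Lfun_mfun /[!inE].
have g0h1 : g0 \* h \in Lfun P 1%E := Lfun2_mul_Lfun1 g02 h2.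
have G0H1 : G0 \* H \in Lfun Q 1%E := Lfun2_mul_Lfun1 G02 H2.
have wG0hE : (fun x => w x * (G0 x * h x)) = G0 \* H.
  by apply/funext => x; rewrite /H /=; ring.
have mG0h : measurable_fun [set: X] (fun x => G0 x * h x).
  by apply: measurable_funM => //; apply: measurable_funB => //; exact: measurable_funM.
(* [G0] is square integrable under [Q] only, so integrability under [P] is pulled back from that of
   [G0 H = w G0 h] under [Q]. *)
have G0h1 : (fun x => G0 x * h x) \in Lfun P 1%E.
  by rewrite (Lfun1_density_ratio Pp Qq mw w_gt0 pwq)// wG0hE.
have EH : 'E_Q[H]%E = 0%E.
  by rewrite -(expectation_density_ratio Pp Qq mw w_gt0 pwq mh).
have covP : covariance P g0 h = 'E_P[g0 \* h]%E.
  exact: covariance_centered.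
have covQ : covariance Q G0 H = 'E_P[(fun x => G0 x * h x)%R]%E.
  by rewrite (covariance_centered G02 H2 EH) (expectation_density_ratio Pp Qq mw w_gt0 pwq)// wG0hE.
have cov_eq : covariance P g0 h = (rho%:E * covariance Q G0 H)%E.
  rewrite covP covQ -expectationZl//.
  have rG0h1 : rho \o* (fun x => G0 x * h x) \in Lfun P 1%E by exact: Lfun_scale.
  (* Pointwise, [g0 h - rho G0 h = h ((1 + rho w) g0 - rho F)], whose mean vanishes by [Ek]. *)
  have : ('E_P[g0 \* h] - 'E_P[rho \o* (fun x => G0 x * h x)%R] = 0)%E.
    rewrite -expectationB// -Ek; congr expectation.
    by apply/funext => x; rewrite /G0 /h /=; ring.
  rewrite -(fineK (expectation_fin_num g0h1)) -(fineK (expectation_fin_num rG0h1)).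
  by rewrite -EFinB => -[/eqP]; rewrite subr_eq0 => /eqP ->.
rewrite GE gE varianceD// varianceB//.
(* All variances and covariances are finite, so the inequality is carried over to real numbers. *)
have := variance_ge0 Q H; have := variance_ge0 P h; move: cov_eq.
rewrite -(fineK (variance_fin_num h2)) -(fineK (variance_fin_num H2)).
rewrite -(fineK (variance_fin_num g02)) -(fineK (variance_fin_num G02)).
have cQ : covariance Q G0 H \is a fin_num.
  by rewrite (covariance_centered G02 H2 EH) expectation_fin_num.
have cP : covariance P g0 h \is a fin_num.
  by rewrite (covariance_centered g02 h2 Eh) expectation_fin_num.
rewrite -(fineK cQ) -(fineK cP) -!EFinM => -[->].
set a := fine _; set b := fine _; set c := fine _; set e := fine _.
set z := fine _.
rewrite !lee_fin => a0 b0.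
rewrite -subr_ge0.
(* Here [a] is the variance of [h] and [b] that of [H]; the covariance [z] occurs with coefficients
   [2 rho / (1 + rho)] and its opposite. *)
rewrite (_ : _ - _ = rho / (1 + rho) * b + 1 / (1 + rho) * a); last first.
  by field; rewrite gt_eqF// addr_gt0.
by rewrite addr_ge0// mulr_ge0// divr_ge0// ?ltW// addr_gt0.
Qed.

End WeightedVariance.

(** * Influence functions and their moment equations *)

Section EstimatingEquation.
Context (R : realType) (disp : measure_display) (X : measurableType disp).
Context (d : nat) (Pn Pd : probability X R) (f : R -> R).
Context (r : X -> 'cV[R]_d -> R) (eta : X -> 'cV[R]_d -> 'cV[R]_d).
Context (fd fn : R -> R) (theta : 'cV[R]_d).
Hypothesis fin_mom : finite_moments Pn Pd f r eta fd fn theta.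

Definition moment_coef : 'rV[R]_d :=
  (c_vec Pn f r fn theta)^T *m invmx (U_mx Pn r eta theta).

Lemma cUetaE x :
  cUeta Pn f r eta fn theta x = \sum_(i < d) moment_coef ord0 i * eta x theta i ord0.
Proof. by rewrite /cUeta -/moment_coef mxE. Qed.

(** Up to centering and scaling, the contribution of one point drawn from [Pn] to the leading term
    of the expansion of the estimator. *)
Definition influence (x : X) : R := fn (r x theta) + cUeta Pn f r eta fn theta x.

Lemma influence_Lfun2 : influence \in Lfun Pn 2%:E.
Proof.
have [_ fn2 eta2 _ _] := fin_mom.
rewrite (_ : influence = (fun x => fn (r x theta)) \+
    \sum_(i < d) moment_coef ord0 i \o* (fun x => eta x theta i ord0)); last first.
  apply/funext => x; rewrite /influence cUetaE /= fct_sumE.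
  by congr (_ + _); apply: eq_bigr => i _; rewrite mulrC.
apply: rpredD => [|//|p1]; first exact: lee1n.
apply: rpred_sum => i _.
by apply: Lfun_scale; [rewrite ler1n | have [] := eta2 i].
Qed.

Lemma weighted_influence_Lfun2 :
  (fun x => fd (r x theta) - r x theta * cUeta Pn f r eta fn theta x)
    \in Lfun Pd 2%:E.
Proof.
have [fd2 _ eta2 _ _] := fin_mom.
rewrite (_ : (fun x => _) = (fun x => fd (r x theta)) \-
    \sum_(i < d) moment_coef ord0 i \o* (fun x => r x theta * eta x theta i ord0)); last first.
  apply/funext => x; rewrite cUetaE /= fct_sumE mulr_sumr.
  by congr (_ - _); apply: eq_bigr => i _; rewrite /=; ring.
apply: rpredB => [|//|p1]; first exact: lee1n.
apply: rpred_sum => i _.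
by apply: Lfun_scale; [rewrite ler1n | have [] := eta2 i].
Qed.

Hypothesis U_unit : U_mx Pn r eta theta \in unitmx.

(** Since [c^T U_eta^-1 U_eta = c^T], the mean of [c^T U_eta^-1 eta] times the j-th score is the
    j-th entry of [c], which is the mean of [f'(r) - fn(r)] times that score. *)
Lemma influence_centered (j : 'I_d) :
  centered Pn (fun x => (influence x - derive1 f (r x theta))
                        * grad_log r x theta j ord0).
Proof.
have [_ _ _ es1 fs1] := fin_mom.
have coefU : \sum_(i < d) moment_coef ord0 i * U_mx Pn r eta theta i j =
    c_vec Pn f r fn theta j ord0.
  have : moment_coef *m U_mx Pn r eta theta = (c_vec Pn f r fn theta)^T by rewrite mulmxKV.
  by move=> /matrixP/(_ ord0 j); rewrite mxE [RHS]mxE.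
(* Each product is centered separately; the subtracted constants are entries of [U_eta] and [c], and
   by [coefU] they cancel in total. *)
have := centeredB
  (centered_sum (moment_coef ord0) (fun i => centered_subr_expectation (es1 i j)))
  (centered_subr_expectation (fs1 j)).
congr centered; apply/funext => x; rewrite /influence cUetaE /=.
under eq_bigr do rewrite mulrBr mulrA.
rewrite sumrB -mulr_suml.
have -> : \sum_(i < d) moment_coef ord0 i * fine ('E_Pn[fun y =>
    (eta y theta i ord0 * grad_log r y theta j ord0)%R])%E =
    c_vec Pn f r fn theta j ord0.
  by rewrite -coefU; apply: eq_bigr => i _; congr (_ * _); rewrite mxE.
by rewrite [X in _ - X - _]mxE; ring.
Qed.

End EstimatingEquation.

(** * Optimality of the proposed estimator *)

Lemma decomposition_opt (R : realType) (f : R -> R) (rho : R) : 0 < rho ->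
  decomposition f (fd_opt rho f) (fn_opt rho f).
Proof.
move=> rho0 t t0; rewrite /fd_opt /fn_opt; field.
by rewrite gt_eqF// addr_gt0// mulr_gt0.
Qed.

Theorem mainTheorem2 (R : realType) (disp : measure_display)
    (X : measurableType disp) (mu : {measure set X -> \bar R})
    (d : nat) (Theta : set 'cV[R]_d) (r : X -> 'cV[R]_d -> R)
    (f : R -> R) (rho : R)
    (* f is strictly convex and differentiable on (0, +oo) *)
    (f_convex : strictly_convex_pos f)
    (f_diff : forall t : R, 0 < t -> derivable f t 1)
    (rho_gt0 : 0 < rho)
    (* the density-ratio model *)
    (r_gt0 : forall (x : X) (theta : 'cV[R]_d), Theta theta -> 0 < r x theta)
    (r_meas : forall theta : 'cV[R]_d, Theta theta ->
       measurable_fun [set: X] (fun x => r x theta))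
    (r_diff : forall (x : X) (theta : 'cV[R]_d), Theta theta ->
       differentiable (r x) theta)
    (* (a), (b), (c) *)
    (model_one : exists2 theta0 : 'cV[R]_d, Theta theta0 &
       forall x : X, r x theta0 = 1)
    (span_one : forall theta : 'cV[R]_d, Theta theta ->
       in_span (fun x => grad_log r x theta) (fun=> 1))
    (f_one : f 1 = 0 /\ derive1 f 1 = 0) :
  decomposition f (fd_opt rho f) (fn_opt rho f) /\
  forall (theta : 'cV[R]_d) (pn pd : X -> R) (Pn Pd : probability X R),
    Theta theta ->
    has_density mu Pn pn ->
    has_density mu Pd pd ->
    (* pn / pd = r(.; theta), allowing pd to vanish (together with pn) *)
    {ae mu, forall x, pn x = r x theta * pd x} ->
    U_mx Pn r (eta_opt rho r) theta \in unitmx ->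
    finite_moments Pn Pd f r (eta_opt rho r) (fd_opt rho f) (fn_opt rho f)
      theta ->
    forall (eta : X -> 'cV[R]_d -> 'cV[R]_d) (fd fn : R -> R),
      decomposition f fd fn ->
      U_mx Pn r eta theta \in unitmx ->
      finite_moments Pn Pd f r eta fd fn theta ->
      (asymptotic_variance Pn Pd rho f r (eta_opt rho r)
         (fd_opt rho f) (fn_opt rho f) theta
       <= asymptotic_variance Pn Pd rho f r eta fd fn theta)%E.
Proof.
have dec0 := decomposition_opt f rho_gt0.
split=> // theta pn pd Pn Pd Th Pnp Pdp ratio U0 fm0 eta fd fn dec U1 fm1.
have w_gt0 x : 0 < r x theta := r_gt0 x theta Th.
have mw := r_meas theta Th.
pose F x := f (r x theta).
pose g := influence Pn f r eta fn theta.
pose g0 := influence Pn f r (eta_opt rho r) (fn_opt rho f) theta.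
(* Positivity of [r] lets the decomposition eliminate [fd], so the [Pd] term too depends on the
   estimator only through its influence. *)
have fdE e fd1 fn1 : decomposition f fd1 fn1 ->
    (fun x => fd1 (r x theta) - r x theta * cUeta Pn f r e fn1 theta x) =
    (fun x => F x - r x theta * influence Pn f r e fn1 theta x).
  by move=> dec1; apply/funext => x; rewrite /F /influence dec1//; ring.
(* Measurability of [f(r)] is read off the moment assumptions, through [fd(r) + r fn(r)]. *)
have mF : measurable_fun [set: X] F.
  have [fd2 fn2 _ _ _] := fm1.
  rewrite (_ : F = fun x => fd (r x theta) + r x theta * fn (r x theta)); last first.
    by apply/funext => x; rewrite /F dec.
  have mfd : measurable_fun [set: X] (fun x => fd (r x theta)).
    by move: fd2 => /sub_Lfun_mfun /[!inE].
  have mfn : measurable_fun [set: X] (fun x => fn (r x theta)).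
    by move: fn2 => /sub_Lfun_mfun /[!inE].
  by apply: measurable_funD => //; exact: measurable_funM.
(* Subtracting the two moment equations removes the common term [f'(r)]. *)
have hs i : centered Pn (fun x => (g x - g0 x) * grad_log r x theta i ord0).
  have := centeredB (influence_centered fm1 U1 i) (influence_centered fm0 U0 i).
  by congr centered; apply/funext => x /=; rewrite /g /g0; ring.
have h0 : centered Pn (g \- g0).
  have [a aE] := span_one theta Th.
  have := centered_sum a hs; congr centered; apply/funext => x /=.
  under eq_bigr do rewrite mulrCA.
  by rewrite -mulr_sumr -aE mulr1.
(* The specific choice of [fn_opt] and [eta_opt] matters here: the factor [1 + rho r] clears both
   denominators, [rho f(r)] cancels, and a combination of scores with constant coefficients is
   left. *)
have g0E x : (1 + rho * r x theta) * g0 x - rho * F x =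
    \sum_(i < d) moment_coef Pn f r (eta_opt rho r) (fn_opt rho f) theta ord0 i
      * grad_log r x theta i ord0.
  have wn0 : 1 + rho * r x theta != 0 by rewrite gt_eqF// addr_gt0// mulr_gt0.
  rewrite /g0 /influence cUetaE mulrDr mulr_sumr.
  rewrite [X in X + _ - _](_ : _ = rho * F x); last by rewrite /fn_opt /F; field.
  rewrite addrAC subrr add0r; apply: eq_bigr => i _.
  by rewrite mulrCA; congr (_ * _); rewrite /eta_opt [X in _ * X = _]mxE mulrA div1r mulfV ?mul1r.
have := weighted_variance_le Pnp Pdp mw w_gt0 ratio rho_gt0 mF
  (influence_Lfun2 fm1) (influence_Lfun2 fm0).
rewrite -(fdE eta _ _ dec) -(fdE (eta_opt rho r) _ _ dec0).
move=> /(_ _ _ h0); apply.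
- exact: weighted_influence_Lfun2 fm1.
- exact: weighted_influence_Lfun2 fm0.
(* By [g0E], orthogonality of [g - g0] to the scores gives the cross-term condition. *)
- have := centered_sum (moment_coef Pn f r (eta_opt rho r) (fn_opt rho f) theta ord0) hs.
  congr centered; apply/funext => x; rewrite g0E mulr_sumr.
  by apply: eq_bigr => i _; rewrite mulrCA.
Qed.
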